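(* Let $F_1,F_2$ be two distinct points in the Euclidean plane and let $O$ be the midpoint of the segment $F_1F_2$. Construct the circle with center at one of the foci $F_1,F_2$ and radius $\frac{1}{\sqrt2}|F_1O|$. On each secant $OAB$ of this circle through $O$ (where $A$ and $B$ are the points of intersection of the circle and the secant), choose the points $X$ and $X'$, on opposite sides of $O$, such that $|AB|=|OX|=|OX'|$. Then the union of all points $X$ and $X'$ forms the lemniscate of Bernoulli with foci $F_1$ and $F_2$.
   Context: The lemniscate of Bernoulli with foci $F_1\neq F_2$ is the set of points $Y$ of the plane such that the product of the distances to the foci equals a quarter of the square of the distance between the foci, that is, $|F_1Y|\cdot|F_2Y|=\frac14|F_1F_2|^2$.
   Formalization: The two tangents to the circle through O are counted as secants with A = B and |AB| = 0, giving X = X' = O; with proper secants only, the union would miss the point O, which lies on the lemniscate. *)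

(* Defs.v *)
From mathcomp Require Import all_boot all_order all_algebra.
From mathcomp Require Import boolp classical_sets reals.

Set Implicit Arguments.
Unset Strict Implicit.
Unset Printing Implicit Defensive.

Import Order.TTheory GRing.Theory Num.Theory.

Local Open Scope classical_set_scope.
Local Open Scope ring_scope.

Section Plane.
Variable R : realType.

(* The Euclidean plane is 'rV[R]_2 with the distance below; the norm that
   MathComp-Analysis puts on row vectors is the sup norm. *)
Notation point := 'rV[R]_2.

Implicit Types (A B C O P Q X Y : point) (l : set point).

Definition edist P Q : R := Num.sqrt (\sum_(i < 2) (P 0 i - Q 0 i) ^+ 2).

Definition midpoint P Q : point := 2^-1 *: (P + Q).

Definition circle C (r : R) : set point := [set P | edist C P = r].

Definition is_line l : Prop :=
  exists P (v : point), v != 0 /\ l = [set P + t *: v | t in [set: R]].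

Definition between O X (X' : point) : Prop :=
  exists2 t : R, 0 <= t <= 1 & O = (1 - t) *: X + t *: X'.

(* A and B are all the points common to l and S. The limiting case A = B is
   allowed, so a tangent to a circle counts as a secant with a chord of
   length 0. *)
Definition is_secant (S : set point) l A B : Prop :=
  is_line l /\ l `&` S = [set A; B].

Definition lemniscate (F1 F2 : point) : set point :=
  [set Y | edist F1 Y * edist F2 Y = 4^-1 * edist F1 F2 ^+ 2].

(* X and X' are points of the line l at distance d from O, on opposite sides
   of O; when d = 0 both are O. *)
Definition opposite_points l O (d : R) X (X' : point) : Prop :=
  [/\ l X, l X', between O X X', d = edist O X & d = edist O X'].

Definition secant_locus (S : set point) O : set point :=
  [set P | exists l A B X X',
    [/\ is_secant S l A B, l O, opposite_points l O (edist A B) X X'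
      & P = X \/ P = X']].

End Plane.

(* Main.v *)
Require Import Defs.
From mathcomp Require Import all_boot all_order all_algebra.
From mathcomp Require Import boolp classical_sets reals.
From mathcomp Require Import ring lra.

(** Put the origin at the midpoint [O] and let the foci be [c] and [- c], so
    that the circle has centre [c] and squared radius [|c|^2 / 2].

    On the line [O + t *: v] the circle is cut out by the quadratic equation
    [t^2 |v|^2 - 2 t <v, c> + |c|^2 / 2 = 0] ([circle_on_line]). By Vieta's
    formulas its roots [t1], [t2] satisfy
    [(t1 - t2)^2 |v|^4 = 4 <v, c>^2 - 2 |c|^2 |v|^2], and the left-hand side is
    the squared chord times [|v|^2]. So if [x] is a multiple of [v] as long as
    the chord, then [|x|^4 + 2 |c|^2 |x|^2 = 4 <x, c>^2] ([secant_quartic]).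
    This quartic is also the expansion of the squared equation of the
    lemniscate ([lemniscate_quartic]).

    Conversely, for [x] nonzero on the quartic the line along [x] is a secant:
    the discriminant of the quadratic for [v = x] is a perfect square, its roots
    being [<x, c> / |x|^2 +- 1/2], and the chord is [x] itself as a vector. The
    point [O], which lies on the lemniscate, comes from a tangent to the circle:
    it makes an angle of 45 degrees with the axis of the foci, and its chord has
    length 0 ([quartic_secant_locus]). *)

Import Order.TTheory GRing.Theory Num.Theory.

Local Open Scope classical_set_scope.
Local Open Scope ring_scope.

Section Plane.
Set Implicit Arguments.
Unset Strict Implicit.
Variable R : realType.
Implicit Types (A B O P Q u v x c : 'rV[R]_2) (r s t : R) (l : set 'rV[R]_2).

Definition dot u v : R := u 0 0 * v 0 0 + u 0 1 * v 0 1.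

Lemma row2P u v : u 0 0 = v 0 0 -> u 0 1 = v 0 1 -> u = v.
Proof.
move=> h0 h1; apply/rowP => i.
case: i => [[|[|//]] lt_i].
  by rewrite (_ : Ordinal lt_i = 0) //; apply/val_inj.
by rewrite (_ : Ordinal lt_i = 1) //; apply/val_inj.
Qed.

Lemma dot_ge0 u : 0 <= dot u u.
Proof. by rewrite /dot -!expr2 addr_ge0 ?sqr_ge0. Qed.

Lemma dot_eq0 u : (dot u u == 0) = (u == 0).
Proof.
apply/idP/eqP => [|->]; last by rewrite /dot !mxE !mul0r addr0.
rewrite /dot -!expr2 paddr_eq0 ?sqr_ge0 // !sqrf_eq0 => /andP[/eqP u0 /eqP u1].
by apply: row2P; rewrite mxE.
Qed.

Lemma edistE P Q : edist P Q = Num.sqrt (dot (P - Q) (P - Q)).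
Proof.
rewrite /edist big_ord_recl big_ord1 /dot !mxE !expr2.
by rewrite (_ : lift ord0 ord0 = 1) //; apply/val_inj.
Qed.

Lemma edist_ge0 P Q : 0 <= edist P Q.
Proof. exact: sqrtr_ge0. Qed.

Lemma edist_sqr P Q : edist P Q ^+ 2 = dot (P - Q) (P - Q).
Proof. by rewrite edistE sqr_sqrtr ?dot_ge0. Qed.

Lemma edist_sqr_inj P Q r : 0 <= r ->
  edist P Q = r <-> dot (P - Q) (P - Q) = r ^+ 2.
Proof.
move=> r0; rewrite -edist_sqr; split=> [->//|/eqP].
by rewrite eqrXn2 ?edist_ge0 // => /eqP.
Qed.

Lemma edistC P Q : edist P Q = edist Q P.
Proof. by apply/edist_sqr_inj; rewrite ?edist_ge0 // edist_sqr /dot !mxE; ring. Qed.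

Lemma lemniscateC P Q : lemniscate P Q = lemniscate Q P.
Proof. by rewrite /lemniscate edistC; apply/seteqP; split=> Y /=; rewrite mulrC. Qed.

(** The polynomial equation of the lemniscate whose foci are [c] and [- c]. *)
Definition quartic c x : Prop :=
  dot x x ^+ 2 + 2 * dot c c * dot x x = 4 * dot x c ^+ 2.

(** Both sides of the defining equation are nonnegative, so it may be squared;
    [|x - c|^2 |x + c|^2 = (|x|^2 + |c|^2)^2 - 4 <x, c>^2] does the rest. *)
Lemma lemniscate_quartic O c x :
  lemniscate (O + c) (O - c) (O + x) <-> quartic c x.
Proof.
have e : lemniscate (O + c) (O - c) (O + x) <->
    (edist (O + c) (O + x) * edist (O - c) (O + x)) ^+ 2 =
    (4^-1 * edist (O + c) (O - c) ^+ 2) ^+ 2.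
  rewrite /lemniscate /=; split=> [->//|/eqP].
  by rewrite eqrXn2 ?mulr_ge0 ?invr_ge0 ?sqr_ge0 ?edist_ge0 // => /eqP.
rewrite e exprMn !edist_sqr /quartic /dot !mxE.
by split=> h; lra.
Qed.

Lemma circle_on_line O c v r t : 0 <= r -> r ^+ 2 = dot c c / 2 ->
  circle (O + c) r (O + t *: v) <->
  t ^+ 2 * dot v v - 2 * t * dot v c + dot c c / 2 = 0.
Proof.
move=> r0 r2; rewrite /circle /= edist_sqr_inj // r2 /dot !mxE.
by split=> h; lra.
Qed.

Lemma line_through O P v : (range (fun t => P + t *: v)) O ->
  range (fun t => P + t *: v) = range (fun t => O + t *: v).
Proof.
case=> t0 _ <-; apply/seteqP; split=> _ [t _ <-].
  by exists (t - t0) => //; rewrite -addrA -scalerDl (addrC t0) subrK.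
by exists (t0 + t) => //; rewrite scalerDl addrA.
Qed.

(** The hypothesis does not record multiplicities. When [t1 = t2] the common
    value is nevertheless a double root, because the second root given by
    Vieta's formula for the sum must again be [t1]. *)
Lemma discriminant_roots (n p q t1 t2 : R) : n != 0 ->
  (forall t, t ^+ 2 * n - 2 * t * p + q = 0 <-> t = t1 \/ t = t2) ->
  ((t1 - t2) * n) ^+ 2 = 4 * p ^+ 2 - 4 * n * q.
Proof.
move=> n0 roots.
have r1 := (roots t1).2 (or_introl erefl).
have r2 := (roots t2).2 (or_intror erefl).
have sum : (t1 + t2) * n = 2 * p.
  have [t12|t12] := eqVneq t1 t2.
    have: 2 * p / n - t1 = t1 \/ 2 * p / n - t1 = t2.
      by apply/roots; rewrite -r1; field.
    by rewrite -t12 => -[] h; rewrite -{1}h subrK divfK.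
  have: (t1 - t2) * ((t1 + t2) * n - 2 * p) = 0 by lra.
  by move/eqP; rewrite mulf_eq0 !subr_eq0 (negbTE t12) => /eqP.
have q1 : q = 2 * t1 * p - t1 ^+ 2 * n by lra.
have p1 : p = (t1 + t2) * n / 2 by lra.
by rewrite q1 p1; field.
Qed.

Lemma add_scale_inj O v s t : v != 0 -> O + s *: v = O + t *: v -> s = t.
Proof.
move=> v0 /addrI /eqP.
by rewrite -subr_eq0 -scalerBl scaler_eq0 (negbTE v0) orbF subr_eq0 => /eqP.
Qed.

Section Locus.
Variables (O c : 'rV[R]_2) (r : R).
Hypotheses (r0 : 0 <= r) (r2 : r ^+ 2 = dot c c / 2).

Lemma secant_quartic l A B x : is_secant (circle (O + c) r) l A B -> l O ->
  l (O + x) -> edist A B = edist O (O + x) -> quartic c x.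
Proof.
move=> [[P [v [v0 ->]]] lS] lO; move: lS; rewrite (line_through lO) => lS.
case=> s _ /addrI <- {x}.
have mem Y : [set A; B] Y -> range (fun t => O + t *: v) Y.
  by rewrite -lS => -[].
have [t1 _ eA] := mem A (or_introl erefl).
have [t2 _ eB] := mem B (or_intror erefl).
move/(edist_sqr_inj _ _ (edist_ge0 _ _)); rewrite edist_sqr => dAB.
have n0 : dot v v != 0 by rewrite dot_eq0.
have roots t : t ^+ 2 * dot v v - 2 * t * dot v c + dot c c / 2 = 0 <->
    t = t1 \/ t = t2.
  rewrite -(circle_on_line O v t r0 r2); split=> [ct|tt].
    have: [set A; B] (O + t *: v) by rewrite -lS; split=> //; exists t.
    by case; rewrite -?eA -?eB => /(add_scale_inj v0); [left|right].
  have: [set A; B] (O + t *: v) by case: tt => ->; [left|right].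
  by rewrite -lS => -[].
have := discriminant_roots n0 roots.
have s2 : s ^+ 2 = (t1 - t2) ^+ 2.
  apply: (mulIf n0); move: dAB; rewrite -eA -eB /dot !mxE => dAB; lra.
rewrite exprMn -s2 => disc.
have dss : dot (s *: v) (s *: v) = s ^+ 2 * dot v v.
  by rewrite /dot !mxE; ring.
have dsc : dot (s *: v) c = s * dot v c by rewrite /dot !mxE; ring.
rewrite /quartic dss dsc.
transitivity (s ^+ 2 * (s ^+ 2 * dot v v ^+ 2 + 2 * dot c c * dot v v)).
  by ring.
by rewrite disc; field.
Qed.

(** The factored equation makes the line along [v] a secant with endpoints at
    parameters [t1] and [t2], and also covers the tangent case [t1 = t2]. *)
Lemma mem_secant_locus v t1 t2 x : v != 0 ->
  (forall t, t ^+ 2 * dot v v - 2 * t * dot v c + dot c c / 2 =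
     dot v v * (t - t1) * (t - t2)) ->
  x = (t1 - t2) *: v -> secant_locus (circle (O + c) r) O (O + x).
Proof.
move=> v0 fact xE.
have n0 : dot v v != 0 by rewrite dot_eq0.
exists (range (fun t => O + t *: v)), (O + t1 *: v), (O + t2 *: v),
  (O + x), (O - x); split; last by left.
- split; first by exists O, v.
  apply/seteqP; split=> [_ [[t _ <-]]|_ [] ->].
  + move/(circle_on_line _ _ _ r0 r2)/eqP; rewrite fact !mulf_eq0 (negbTE n0) /=.
    by rewrite !subr_eq0 => /orP[] /eqP ->; [left|right].
  + split; first by exists t1.
    by apply/circle_on_line => //; rewrite fact; ring.
  + split; first by exists t2.
    by apply/circle_on_line => //; rewrite fact; ring.
- by exists 0 => //; rewrite scale0r addr0.
- split.
  + by exists (t1 - t2); rewrite ?xE.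
  + by exists (- (t1 - t2)) => //; rewrite xE scaleNr.
  + by exists 2^-1; [lra|apply: row2P; rewrite !mxE; field].
  + apply/edist_sqr_inj; rewrite ?edist_ge0 // edist_sqr xE /dot !mxE; ring.
  + apply/edist_sqr_inj; rewrite ?edist_ge0 // edist_sqr xE /dot !mxE; ring.
Qed.

(** For nonzero [x] on the quartic, the reduced discriminant
    [<x, c>^2 - |x|^2 |c|^2 / 2] of the quadratic along [x] equals [|x|^4 / 4],
    so its roots differ by exactly 1. *)
Lemma quartic_secant_locus x : c != 0 -> quartic c x ->
  secant_locus (circle (O + c) r) O (O + x).
Proof.
move=> c0 qx; have [->|x0] := eqVneq x 0.
  (* [c] plus its quarter turn: the direction of a tangent through [O], which
     touches the circle at parameter 1/2. *)
  pose v : 'rV[R]_2 := \row_i (if i == 0 then c 0 0 - c 0 1 else c 0 0 + c 0 1).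
  have vv : dot v v = 2 * dot c c by rewrite /dot !mxE /=; ring.
  have vc : dot v c = dot c c by rewrite /dot !mxE /=; ring.
  have v0 : v != 0 by rewrite -dot_eq0 vv mulf_neq0 ?dot_eq0 ?pnatr_eq0.
  apply: (@mem_secant_locus v 2^-1 2^-1) => // [t|].
    by rewrite vv vc; field.
  by rewrite subrr scale0r.
have n0 : dot x x != 0 by rewrite dot_eq0.
pose m := dot x c / dot x x.
apply: (@mem_secant_locus x (m + 2^-1) (m - 2^-1)) => // [t|]; last first.
  by rewrite (_ : _ - _ = 1) ?scale1r //; field.
have cc : dot c c = (4 * dot x c ^+ 2 - dot x x ^+ 2) / (2 * dot x x).
  by rewrite -qx; field.
by rewrite /m cc; field.
Qed.

Lemma secant_locus_quartic x : c != 0 ->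
  secant_locus (circle (O + c) r) O (O + x) <-> quartic c x.
Proof.
move=> c0; split; last exact: quartic_secant_locus.
move=> [l [A [B [X [X' [sec lO [lX lX' _ dX dX'] eP]]]]]].
by apply: (secant_quartic sec) => //; case: eP => ->.
Qed.

End Locus.
End Plane.

Theorem mainTheorem2 (R : realType) (F1 F2 O C : 'rV[R]_2)
    (hF : F1 <> F2) (hO : O = midpoint F1 F2) (hC : C = F1 \/ C = F2) :
  secant_locus (circle C ((Num.sqrt 2)^-1 * edist F1 O)) O = lemniscate F1 F2.
Proof.
pose c := C - O.
have F12 : (F1 = O + c /\ F2 = O - c) \/ (F1 = O - c /\ F2 = O + c).
  by case: hC => hC; [left|right]; split;
    apply: row2P; rewrite /c hC hO !mxE; field.
have eC : C = O + c by rewrite addrC subrK.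
have c0 : c != 0.
  apply/eqP => c0; apply: hF.
  by case: F12 => -[-> ->]; rewrite c0 subr0 addr0.
set r := _^-1 * _.
have r0 : 0 <= r by rewrite mulr_ge0 ?edist_ge0 // invr_ge0 sqrtr_ge0.
have r2 : r ^+ 2 = dot c c / 2.
  rewrite exprMn exprVn sqr_sqrtr ?ler0n // edist_sqr mulrC; congr (_ / _).
  by case: F12 => -[-> _]; rewrite /dot !mxE; ring.
have -> : lemniscate F1 F2 = lemniscate (O + c) (O - c).
  by case: F12 => -[-> ->] //; rewrite lemniscateC.
apply/seteqP; split=> P; rewrite eC -(subrK O P) (addrC _ O).
  by move/(secant_locus_quartic O r0 r2 _ c0)/lemniscate_quartic.
by move/lemniscate_quartic/(secant_locus_quartic O r0 r2 _ c0).
Qed.
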